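(* Suppose $\widehat{M}_V\neq\emptyset$. Then for every $X\in L_U$, \[ \pi(X;C_U)=\sup_{\mathbb{Q}\in\widehat{M}_V}\mathbb{E}_{\mathbb{Q}}[X], \] where $\pi(X;C_U)=\inf\{x\in\mathbb{R}: X\le x+Y\text{ for some }Y\in C_U\}$.
   Context: Let $(\Omega,\mathcal{F},\mathbb{P})$ be a probability space and $K\subseteq L^0(\mathbb{P})$ a convex cone (of terminal wealths). Let $a\in[-\infty,\infty)$ and $U:(a,\infty)\to\mathbb{R}$ be increasing, strictly concave, continuously differentiable with $\lim_{x\downarrow a}U'(x)=\infty$ and $\lim_{x\uparrow\infty}U'(x)=0$; if $a=-\infty$, assume moreover $\liminf_{x\to-\infty}\frac{xU'(x)}{U(x)}>1$. Let $V(y)=\sup_{x\in(a,\infty)}\{U(x)-xy\}$ for $y>0$ and $V^+=\max\{V,0\}$. Define $M_1=\{\mathbb{Q}\ll\mathbb{P}: X\in L^1(\mathbb{Q})\text{ and }\mathbb{E}_{\mathbb{Q}}[X]\le 0\text{ for all }X\in K\}$. A measure $\mathbb{Q}\ll\mathbb{P}$ has finite loss-entropy if there is $b>0$ with $\mathbb{E}_{\mathbb{P}}\big[V^+\big(\tfrac{d\mathbb{Q}}{d\mathbb{P}}\big)\mathbf{1}_{\{d\mathbb{Q}/d\mathbb{P}\ge b\}}\big]<\infty$; $\widehat{M}_V=\{\mathbb{Q}\in M_1:\mathbb{Q}\text{ has finite loss-entropy}\}$. Let $L_U=\bigcap_{\mathbb{Q}\in\widehat{M}_V}L^1(\mathbb{Q})$,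 let $L_V^+\subseteq L^1(\mathbb{P})$ be the linear span of the densities $d\mathbb{Q}/d\mathbb{P}$, $\mathbb{Q}\in\widehat{M}_V$, paired with $L_U$ via $\langle X,X^+\rangle=\mathbb{E}_{\mathbb{P}}[XX^+]$. Let $K_U=\{X\in L_U: X\le\widetilde X\text{ for some }\widetilde X\in K\}$ and $C_U$ the closure of $K_U$ in the weak topology $\sigma(L_U,L_V^+)$. *)

(* Defs.v *)
From HB Require Import structures.
From mathcomp Require Import all_boot all_order all_algebra.
From mathcomp Require Import all_classical all_reals all_analysis.
Set Implicit Arguments. Unset Strict Implicit. Unset Printing Implicit Defensive.
Import Order.TTheory GRing.Theory Num.Theory.
Import numFieldNormedType.Exports.
Local Open Scope classical_set_scope.
Local Open Scope ring_scope.

Section Superhedging.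
Context (R : realType) (d : measure_display) (Omega : measurableType d)
  (P : probability Omega R).

Definition dom (a : \bar R) : set R := [set x : R | (a < x%:E)%E].

Definition Vconj (a : \bar R) (U : R -> R) (y : R) : \bar R :=
  ereal_sup [set (U x - x * y)%:E | x in dom a].

Definition Vplus (a : \bar R) (U : R -> R) (y : R) : \bar R :=
  Order.max (Vconj a U y) 0%E.

(* Measures Q << P are represented by their densities Z = dQ/dP. *)
Definition is_density (Z : Omega -> R) : Prop :=
  [/\ measurable_fun setT Z, (forall w, 0 <= Z w)
    & (\int[P]_w (Z w)%:E = 1)%E].

Definition L1Q (Z X : Omega -> R) : Prop :=
  (\int[P]_w (`|X w| * Z w)%:E < +oo)%E.

Definition EQ (Z X : Omega -> R) : \bar R := \int[P]_w (X w * Z w)%:E.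

Definition M1 (K : set (Omega -> R)) (Z : Omega -> R) : Prop :=
  is_density Z /\ forall X, K X -> L1Q Z X /\ (EQ Z X <= 0)%E.

Definition finite_loss_entropy (a : \bar R) (U : R -> R) (Z : Omega -> R) : Prop :=
  exists b : R, 0 < b /\
    (\int[P]_w (if (b <= Z w)%R then Vplus a U (Z w) else 0%E) < +oo)%E.

Definition MhatV (K : set (Omega -> R)) (a : \bar R) (U : R -> R)
  (Z : Omega -> R) : Prop :=
  M1 K Z /\ finite_loss_entropy a U Z.

Definition LU K a U (X : Omega -> R) : Prop :=
  measurable_fun setT X /\ forall Z, MhatV K a U Z -> L1Q Z X.

(* L_V^+ = linear span of the densities of \hat M_V (as elements of L^1(P)) *)
Definition LVplus K a U (Z : Omega -> R) : Prop :=
  exists (n : nat) (c : 'I_n -> R) (Zs : 'I_n -> Omega -> R),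
    (forall i, MhatV K a U (Zs i)) /\
    {ae P, forall w, Z w = \sum_(i < n) c i * Zs i w}.

Definition pairing (X Z : Omega -> R) : \bar R := \int[P]_w (X w * Z w)%:E.

Definition KU K a U (X : Omega -> R) : Prop :=
  LU K a U X /\ exists Xt, K Xt /\ {ae P, forall w, X w <= Xt w}.

(* C_U: closure of K_U in sigma(L_U, L_V^+), via the basic weak neighbourhoods
   { Y : |<Y - X, Z_i>| < eps, i < n } with Z_i in L_V^+ *)
Definition CU K a U (X : Omega -> R) : Prop :=
  LU K a U X /\
  forall (n : nat) (Zs : 'I_n -> Omega -> R) (eps : R),
    (forall i, LVplus K a U (Zs i)) -> 0 < eps ->
    exists Y, KU K a U Y /\
      forall i, (`| pairing (fun w => (Y w - X w)%R) (Zs i) | < eps%:E)%E.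

Definition superhedging_price K a U (X : Omega -> R) : \bar R :=
  ereal_inf [set x%:E | x in
    [set x : R | exists Y, CU K a U Y /\ {ae P, forall w, X w <= x + Y w}]].

End Superhedging.

(* Main.v *)
(**
A measure in the set of dual elements integrates the terminal wealths to
something nonpositive, and this passes to the weak closure [CU], whence the
bound of the price from below.  Conversely, if [X - x] is not in [CU], the
failure is witnessed by finitely many elements of [LVplus], so a separation of
a point from a convex cone in a finite-dimensional space gives one element [Z]
of [LVplus] which is nonpositive on [KU] and positive at [X - x].  Testing on
minus indicators shows [Z >= 0], and the normalisation of [Z] is the density of
a martingale measure.  It has finite loss-entropy because [Z] is bounded by a
multiple of one density in [MhatV] and the entropy condition is stable under
such domination: for finite [a] the conjugate [V] grows at most linearly, and
for [a = -oo] the elasticity condition on [U] yields [V (L y) <= C V y] for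
large [y].
*)
Require Import Defs.
From HB Require Import structures.
From mathcomp Require Import all_boot all_order all_algebra.
From mathcomp Require Import all_classical all_reals all_analysis.
From mathcomp Require Import measurable_realfun ring lra.
Set Implicit Arguments.
Unset Strict Implicit.
Unset Printing Implicit Defensive.
Import Order.TTheory GRing.Theory Num.Theory.
Import numFieldNormedType.Exports.
Local Open Scope classical_set_scope.
Local Open Scope ring_scope.

(** * Integrals of possibly nonmeasurable functions *)

Section LowerIntegral.
Context {R : realType} {d : measure_display} {T : measurableType d}.
Variable mu : {measure set T -> \bar R}.
Local Open Scope ereal_scope.
Import HBNNSimple.

(* The integral of a nonnegative function is a supremum over the simple
   functions below it, hence monotone even without measurability. *)
Lemma ae_ge0_le_lower_integral (f g : T -> \bar R) :
  (forall x, 0 <= f x) -> (forall x, 0 <= g x) ->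
  {ae mu, forall x, f x <= g x} ->
  \int[mu]_x f x <= \int[mu]_x g x.
Proof.
move=> f0 g0 [N [mN muN fgN]].
rewrite ge0_integralTE// [leRHS]ge0_integralTE//.
apply: ge_ereal_sup => _ [h /= hf <-].
have mNC : measurable (~` N) by exact: measurableC.
(* Cutting [h] to zero on the null set [N] leaves its integral unchanged and puts it below [g]
   everywhere. *)
apply: ereal_sup_ubound; exists (proj_nnsfun h mNC).
  move=> x; rewrite -mrestrict patchE.
  have [xN|xN] := boolP (x \in ~` N); last exact: g0.
  rewrite (le_trans (hf x))//; apply: contrapT => fgx.
  by move: xN; rewrite inE; apply; exact: fgN.
rewrite -!integralT_nnsfun; apply: ae_eq_integral => //.
- exact/measurable_EFinP/measurable_funPT.
- exact/measurable_EFinP/measurable_funPT.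
exists N; split => // x /=; apply: contra_notP => xN _.
by rewrite /= mindicE mem_set// mulr1.
Qed.

(** Free of measurability because an element of [LVplus] is only a.e. equal to a combination of
    densities. *)
Lemma ae_eq_lower_integral (f g : T -> \bar R) :
  {ae mu, forall x, f x = g x} ->
  \int[mu]_x f x = \int[mu]_x g x.
Proof.
move=> fg; rewrite integralE [RHS]integralE; congr (_ - _).
- by apply/eqP; rewrite eq_le; apply/andP; split;
    apply: ae_ge0_le_lower_integral => //; apply: filterS fg => x fgx;
    rewrite !funeposE fgx.
- by apply/eqP; rewrite eq_le; apply/andP; split;
    apply: ae_ge0_le_lower_integral => //; apply: filterS fg => x fgx;
    rewrite !funenegE fgx.
Qed.

(** The preimage of a ray unbounded above is an up-set of the line, hence an interval. *)
Lemma nondecreasing_emeasurable (f : R -> \bar R) :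
  {homo f : x y / (x <= y)%R >-> x <= y} -> measurable_fun setT f.
Proof.
move=> f_nd.
apply: (measurability (@ErealGenCInfty.G R)) => [|/= _ [_] [r] -> <-].
  exact: ErealGenCInfty.measurableE.
rewrite setTI; apply: is_interval_measurable => s t/=.
rewrite !in_itv/= !andbT => fs ft u /andP[su ut].
by rewrite in_itv/= andbT (le_trans fs)// f_nd.
Qed.

End LowerIntegral.

(** * Separation of a point from a convex cone in finite dimension *)

Section ConeSeparation.
Context {R : realType} {n : nat}.
Implicit Types c p q : 'rV[R]_n.

Definition dotp c p : R := \sum_(i < n) c ord0 i * p ord0 i.

Lemma dotpNr c p : dotp c (- p) = - dotp c p.
Proof. by rewrite /dotp -sumrN; apply: eq_bigr => i _; rewrite !mxE mulrN. Qed.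

Lemma dotpBZ c p (s : R) : dotp (c - s *: p) (c - s *: p) =
  dotp c c - s * dotp c p *+ 2 + s ^+ 2 * dotp p p.
Proof.
rewrite /dotp mulr_sumr -sumrMnl mulr_sumr -sumrB -big_split/=.
by apply: eq_bigr => i _; rewrite !mxE; ring.
Qed.

Lemma dotp_ge0 c : 0 <= dotp c c.
Proof. by apply: sumr_ge0 => i _; rewrite -expr2 sqr_ge0. Qed.

Lemma sqr_coord_le_dotp c i : c ord0 i ^+ 2 <= dotp c c.
Proof.
rewrite /dotp (bigD1 i)//= -expr2 lerDl sumr_ge0// => j _.
by rewrite -expr2 sqr_ge0.
Qed.

Lemma dotp_continuousl p : continuous (dotp ^~ p).
Proof.
rewrite /dotp; apply: continuous_big => [x|i _ c]; first exact: add_continuous.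
apply: (@cvgMr_tmp _ _ (nbhs c)); exact: coord_continuous.
Qed.

(* Near-minimisers of the distance from p to the cone satisfy the separating
   inequalities up to a small error; a cluster point satisfies them exactly. *)
Lemma cone_separation (A : set 'rV[R]_n) (p : 'rV[R]_n) (eps : R) :
  A 0 ->
  (forall q q' (s t : R), A q -> A q' -> 0 <= s -> 0 <= t ->
     A (s *: q + t *: q')) ->
  0 < eps -> (forall q, A q -> exists i, eps <= `|q ord0 i - p ord0 i|) ->
  exists c, (forall q, A q -> dotp c q <= 0) /\ 0 < dotp c p.
Proof.
move=> A0 Acone eps0 Ap.
pose D := [set dotp (p - q) (p - q) | q in A].
have lbD : lbound D (eps ^+ 2).
  move=> _ [q /Ap[i Hi] <-]; apply: le_trans (sqr_coord_le_dotp _ i).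
  rewrite -[leRHS]real_normK ?num_real// ler_sqr ?nnegrE ?(ltW eps0)//.
  by rewrite !mxE distrC.
have hD : has_inf D by split; [exists (dotp (p - 0) (p - 0)), 0|exists (eps ^+ 2)].
pose del := inf D.
have del0 : 0 < del.
  apply: (@lt_le_trans _ _ (eps ^+ 2)); first by rewrite exprn_gt0.
  by apply: lb_le_inf => //; exact: hD.1.
have Dge q : A q -> del <= dotp (p - q) (p - q).
  by move=> Aq; apply: ge_inf; [exact: hD.2|exists q].
have near_min (m : nat) : exists q, A q /\
    dotp (p - q) (p - q) < del + m.+1%:R^-1.
  have e0 : 0 < m.+1%:R^-1 :> R by rewrite invr_gt0.
  by have [_ [q Aq <-] h] := inf_adherent e0 hD; exists q.
have [q_ q_P] := choice near_min.
pose c_ m := p - q_ m.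
pose B := del + 1.
have c_B m : dotp (c_ m) (c_ m) <= B.
  apply: ltW; apply: lt_le_trans (q_P m).2 _.
  by rewrite /B lerD2l invf_le1// ler1n.
have Bge1 : 1 <= B by rewrite /B lerDr ltW.
have [c [_ cc]] : [set v : 'rV[R]_n | forall i, `[- B, B]%classic (v ord0 i)] `&`
    cluster (c_ @ \oo) !=set0.
  apply: (rV_compact (fun=> @segment_compact R (- B) B)).
  exists 0%N => // m _ i; rewrite /= in_itv/= -ler_norml.
  have := le_trans (sqr_coord_le_dotp (c_ m) i) (c_B m).
  rewrite -[X in X <= _]real_normK ?num_real// => h.
  rewrite leNgt; apply/negP => h'; nra.
(* A bound holding on the tail of [c_] where the error [m.+1%:R^-1] is below [e] passes to the
   cluster point [c]. *)
have closedP (f : 'rV[R]_n -> R) (r e : R) : 0 < e -> continuous f ->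
    (forall m, m.+1%:R^-1 < e -> f (c_ m) <= r) -> f c <= r.
  move=> e0 cf fr; move: cc; rewrite clusterE => /(_ (f @^-1` [set x | x <= r])).
  have cl : closed (f @^-1` [set x | x <= r]).
    by apply: preimage_closed => [x _|]; [exact: cf|exact: closed_le].
  rewrite -(closure_id _).1//; apply.
  by apply: filterS (near_infty_natSinv_lt (PosNum e0)) => m; exact: fr.
exists c; split.
  move=> q Aq; rewrite leNgt; apply/negP => cq0.
  pose Q := dotp q q; have Q0 : 0 <= Q by exact: dotp_ge0.
  have Q1 : 0 < 1 + Q by lra.
  (* Moving from [q_ m] to [q_ m + s *: q] cannot bring the squared distance below [del]. For errors
     below [s ^+ 2] this gives [dotp (c_ m) q <= s * (1 + Q) / 2], and the choice of [s] makes the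
     right side half of [dotp c q], which is absurd. *)
  pose s := dotp c q / (1 + Q); have s0 : 0 < s by rewrite divr_gt0.
  have : dotp c q <= s * (1 + Q) / 2.
    apply: (@closedP (dotp ^~ q) _ (s ^+ 2)).
    - by rewrite exprn_gt0.
    - exact: dotp_continuousl.
    move=> m me; have := Dge (1 *: q_ m + s *: q).
    move=> /(_ (Acone _ _ _ _ (q_P m).1 Aq ler01 (ltW s0))).
    rewrite scale1r opprD addrA dotpBZ -/(c_ m) -/Q.
    have := (q_P m).2; rewrite -/(c_ m) => h1 h2.
    have h3 : s * (dotp (c_ m) q *+ 2) <= s * (s * (1 + Q)).
      rewrite -mulrnAr in h2; move: Q s s0 me h1 h2 {Q0 Q1} => Q s s0.
      move: (m.+1%:R^-1) (dotp (c_ m) (c_ m)) (dotp (c_ m) q) => e u v.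
      by nra.
    rewrite ler_pM2l// in h3; lra.
  by rewrite /s divfK ?gt_eqF// => ?; lra.
(* [M] bounds [dotp (q_ m) (q_ m)]. Comparing [q_ m] with its shrinking by the factor [1 - s] gives
   [dotp (c_ m) (q_ m) >= - (del / 2)]; adding [dotp (c_ m) (c_ m) >= del] yields
   [dotp (c_ m) p >= del / 2]. *)
pose M := (dotp p p + B) *+ 2 + 1.
have M1 : 1 <= M by rewrite /M; have := dotp_ge0 p; lra.
pose s := Num.min 1 (del / 2 / M).
have s0 : 0 < s by rewrite /s lt_min ltr01/= divr_gt0 ?divr_gt0//; lra.
have s1 : s <= 1 by rewrite /s ge_min lexx.
have sM : s * M <= del / 2 by rewrite -ler_pdivlMr ?ge_min ?lexx ?orbT//; lra.
suff : dotp c (- p) <= - (del / 2) by rewrite dotpNr; lra.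
apply: (@closedP (dotp ^~ (- p)) _ (s * (del / 2))).
- by rewrite mulr_gt0// divr_gt0.
- exact: dotp_continuousl.
move=> m me; have := Dge ((1 - s) *: q_ m + 0 *: 0).
have s1' : 0 <= 1 - s by lra.
move=> /(_ (Acone _ _ _ _ (q_P m).1 A0 s1' (lexx _))).
have -> : p - ((1 - s) *: q_ m + 0 *: 0) = c_ m - (- s) *: q_ m.
  by rewrite /c_ scale0r addr0 scalerBl scale1r opprB scaleNr opprK -addrA [- q_ m + _]addrC addrA.
rewrite dotpBZ => h2; have h1 := (q_P m).2; rewrite -/(c_ m) in h1.
have cpE : dotp (c_ m) p = dotp (c_ m) (c_ m) + dotp (c_ m) (q_ m).
  by rewrite /dotp -big_split; apply: eq_bigr => i _; rewrite !mxE/=; ring.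
have qM : dotp (q_ m) (q_ m) <= M.
  have -> : q_ m = p - 1 *: c_ m by rewrite /c_ scale1r subKr.
  rewrite dotpBZ; have := dotp_ge0 (p - (-1) *: c_ m); rewrite dotpBZ /M.
  by have := c_B m; lra.
have h4 : s * (s * dotp (q_ m) (q_ m)) <= s * (del / 2).
  by rewrite ler_pM2l// (le_trans _ sM)// ler_pM2l.
have h5 : - (s * (dotp (c_ m) (q_ m) *+ 2)) <= s * del.
  rewrite -mulrnAr in h2; move: h1 h2 h4 me; move: s s0 {s1 sM s1'} => s s0.
  move: (m.+1%:R^-1) (dotp (c_ m) (c_ m)) (dotp (c_ m) (q_ m))
    (dotp (q_ m) (q_ m)) => e u v w.
  by nra.
rewrite -mulrN ler_pM2l// in h5.
by have := Dge _ (q_P m).1; rewrite -/(c_ m) dotpNr cpE; lra.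
Qed.

End ConeSeparation.

(** * Growth of the conjugate of the utility *)

Lemma le_expr_of_gt1 {R : realType} (x L : R) : 1 < x -> exists k, L <= x ^+ k.
Proof.
move=> x1.
have bern k : 1 + k%:R * (x - 1) <= x ^+ k.
  elim: k => [|k IHk]; first by rewrite mul0r addr0 expr0.
  rewrite exprS -natr1; apply: (@le_trans _ _ (x * (1 + k%:R * (x - 1)))).
    have : 0 <= k%:R * (x - 1) ^+ 2 by rewrite mulr_ge0// sqr_ge0.
    by move: (k%:R) => r; lra.
  by rewrite ler_pM2l//; lra.
exists (Num.bound `|L / (x - 1)|); apply: le_trans (bern _).
have := archi_boundP (normr_ge0 (L / (x - 1))); move: (Num.bound _)%:R => r Lr.
have : L / (x - 1) < r by exact: le_lt_trans (ler_norm _) Lr.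
by rewrite ltr_pdivrMr ?subr_gt0//; lra.
Qed.

Section Utility.
Context {R : realType} (a : \bar R) (U : R -> R).
Hypothesis hU_sconc : forall x y (t : R), dom a x -> dom a y -> x != y ->
  0 < t -> t < 1 -> t * U x + (1 - t) * U y < U (t * x + (1 - t) * y).
Hypothesis hU_der : forall x, dom a x -> derivable U x 1.

(** By concavity the difference quotients from [x] towards [z] stay above [U z - U x]; the step then
    tends to [0] from the right. *)
Lemma utility_le_tangent x z : dom a x -> dom a z ->
  U z <= U x + (derive1 U) x * (z - x).
Proof.
move=> ax az; have [->|zx] := eqVneq z x; first by rewrite subrr mulr0 addr0.
have dU : differentiable U x by exact/derivable1_diffP/hU_der.
have Dv : 'D_(z - x) U x = (derive1 U) x * (z - x).
  by rewrite deriveE// diff1E//= mulrC.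
rewrite -lerBlDl -Dv.
have /cvg_dnbhs_at_right : h^-1 *: ((U \o shift x) (h *: (z - x)) - U x)
    @[h --> 0^'] --> 'D_(z - x) U x.
  exact: diff_derivable.
move/cvgr_to_ge; apply; near=> h.
have h0 : 0 < h by near: h; exact: nbhs_right_gt.
have h1 : h < 1 by near: h; exact: nbhs_right_lt.
rewrite /= -[_ *: _]/(_ * _) mulrC ler_pdivlMr// -[_ *: _]/(_ * _).
have := hU_sconc az ax zx h0 h1.
have -> : h * z + (1 - h) * x = h * (z - x) + x by ring.
by lra.
Unshelve. all: by end_near. Qed.

Hypothesis hU_inada_inf : (derive1 U) x @[x --> +oo] --> 0.

(** A tangent of slope at most [1] lies above [U]. For [y >= 1], tangent minus [x * y] is
    nonincreasing in [x], hence bounded by its value at the left end [r]. *)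
Lemma Vplus_linear_bound (r : R) : a = r%:E ->
  exists A : R, forall y, 1 <= y -> (Vplus a U y <= (A + `|r| * y)%:E)%E.
Proof.
move=> ar; have [x0 [x0r x01]] : exists x0, r < x0 /\ (derive1 U) x0 <= 1.
  have /cvgr_le/(_ _ ltr01) near1 := hU_inada_inf.
  near (pinfty_nbhs R) => x0; exists x0; split.
    by near: x0; apply: nbhs_pinfty_gt; rewrite num_real.
  by near: x0.
pose A := U x0 + (derive1 U) x0 * (r - x0).
exists `|A| => y y1; rewrite /Vplus ge_max; apply/andP; split; last first.
  by rewrite lee_fin addr_ge0// mulr_ge0//; lra.
apply: ge_ereal_sup => _ [x ax <-]; rewrite lee_fin.
have ax0 : dom a x0 by rewrite /dom ar /= lte_fin.
have rx : r < x by move: ax; rewrite /dom ar /= lte_fin.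
have := utility_le_tangent ax0 ax.
have : (y - (derive1 U) x0) * (x - r) >= 0 by apply: mulr_ge0; lra.
have : A <= `|A| by exact: ler_norm.
have : (- r) * y <= `|r| * y by rewrite ler_wpM2r// -1?normrN ?ler_norm//; lra.
move: `|A| `|r| => A' r'; rewrite /A; nra.
Unshelve. all: by end_near. Qed.

Lemma Vconj_ge (x y : R) : dom a x -> ((U x - x * y)%:E <= Vconj a U y)%E.
Proof. by move=> ax; apply: ereal_sup_ubound; exists x. Qed.

Hypothesis hU_inada0_inf : a = -oo%E -> (derive1 U) x @[x --> -oo] --> +oo.
Hypothesis hU_ae : a = -oo%E ->
  exists c : R, 1 < c /\ \forall x \near -oo, c <= x * (derive1 U) x / U x.

(** Far to the left [U] is negative, so clearing the denominator of the elasticity quotient reverses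
    the inequality. *)
Lemma utility_elasticity : a = -oo%E -> exists c s0 : R, [/\ 1 < c, 0 < s0 &
  forall x, x <= - s0 -> x * (derive1 U) x <= c * U x].
Proof.
move=> aoo; have [c [c1 nearc]] := hU_ae aoo.
have domT x : dom a x by rewrite /dom aoo /= ltNyr.
have /cvgryPge/(_ 1) near1 := hU_inada0_inf aoo.
have [x1 x1P] : exists x1, 1 <= (derive1 U) x1.
  by near (ninfty_nbhs R) => x1; exists x1; near: x1.
have [M [_ MP]] := nearc.
(* The term with [M] enters the range of the elasticity bound. The last term forces [U x < 0],
   through the tangent at [x1], whose slope is at least [1]. *)
pose s0 := Num.max 1 (Num.max (1 - M) (1 - (x1 - `|U x1|))).
exists c, s0; split => //; first by rewrite lt_max ltr01.
move=> x xs; have : s0 <= - x by lra.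
rewrite !ge_max => /and3P[x_1 xM xx1].
have Ux : U x < 0.
  have := utility_le_tangent (domT x1) (domT x); have := ler_norm (U x1).
  have := normr_ge0 (U x1); move: `|U x1| xx1 => u; nra.
have /MP : x < M by lra.
by rewrite ler_ndivlMr.
Unshelve. all: by end_near. Qed.

(* With g s = - U (- s), convexity and elasticity give g (2 t) >= (1 + c) g t,
   and substituting s = 2 t in the supremum defining V yields the doubling
   estimate for the dilation factor (1 + c) / 2. *)
Lemma Vplus_growth : a = -oo%E -> exists y0 : R, [/\ 0 < y0,
  (forall y z, y0 <= y -> y <= z -> (Vplus a U y <= Vplus a U z)%E) &
  forall L : R, exists C : R, 0 <= C /\
    forall y z, y0 <= y -> y0 <= z -> z <= L * y ->
      (Vplus a U z <= C%:E * Vplus a U y)%E].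
Proof.
move=> aoo; have [c [s0 [c1 s00 elas]]] := utility_elasticity aoo.
have domT x : dom a x by rewrite /dom aoo /= ltNyr.
(* For [y >= y0] the supremum defining [V] only involves [x <= p]. There [x / 2 <= - s0], so
   elasticity is still available at the halved point. *)
pose p := - (2 * s0); pose y0 := Num.max 1 ((derive1 U) p).
have y00 : 0 < y0 by rewrite lt_max ltr01.
have red x y : y0 <= y -> p <= x -> U x - x * y <= U p - p * y.
  rewrite ge_max => /andP[_ yp] px.
  have := utility_le_tangent (domT p) (domT x).
  have : 0 <= (y - (derive1 U) p) * (x - p) by rewrite mulr_ge0// subr_ge0.
  nra.
have VP y (M : \bar R) : y0 <= y ->
    (forall x, x <= p -> ((U x - x * y)%:E <= M)%E) -> (Vconj a U y <= M)%E.
  move=> yy0 h; apply: ge_ereal_sup => _ [x _ <-].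
  have [/h//|px] := leP x p.
  by apply: le_trans (h p (lexx _)); rewrite lee_fin red// ltW.
have V0 y : (0 <= Vplus a U y)%E by rewrite le_max lexx orbT.
have Vmono y z : y0 <= y -> y <= z -> (Vplus a U y <= Vplus a U z)%E.
  move=> yy yz; rewrite ge_max V0 andbT le_max; apply/orP; left.
  apply: VP => // x xp; apply: le_trans (Vconj_ge z (domT x)).
  by rewrite lee_fin lerD2l lerN2 ler_wnM2l//; rewrite /p in xp; lra.
pose lam := (1 + c) / 2; have lam1 : 1 < lam by rewrite /lam; lra.
have Vdil y : y0 <= y -> (Vplus a U (lam * y) <= (1 + c)%:E * Vplus a U y)%E.
  move=> yy; have c0 : 0 <= 1 + c by lra.
  rewrite ge_max mule_ge0 ?lee_fin// andbT.
  apply: VP => [|x xp].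
    by apply: (le_trans yy); apply: ler_peMl; lra.
  apply: (@le_trans _ _ ((1 + c)%:E * (U (x / 2) - x / 2 * y)%:E)%E).
    have x2 : x / 2 <= - s0 by rewrite /p in xp; lra.
    have := elas _ x2; have := utility_le_tangent (domT (x / 2)) (domT x).
    rewrite -EFinM lee_fin /lam; move: (U (x / 2)) (derive1 U (x / 2)) => u u'.
    nra.
  apply: lee_wpmul2l; first by rewrite lee_fin.
  by rewrite le_max Vconj_ge.
exists y0; split => // L.
(* Iterating the dilation by [lam] absorbs any factor [L], at the cost of the constant
   [(1 + c) ^+ k]. *)
have [k Lk] := le_expr_of_gt1 L lam1.
exists ((1 + c) ^+ k); split; first by rewrite exprn_ge0//; lra.
move=> y z yy zz zL.
have lamk (j : nat) : y0 <= lam ^+ j * y.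
  apply: (le_trans yy); apply: ler_peMl; first lra.
  by rewrite exprn_ege1// ltW.
apply: (@le_trans _ _ (Vplus a U (lam ^+ k * y))).
  apply: Vmono => //; apply: (le_trans zL).
  by rewrite ler_wpM2r// (le_trans (ltW y00)).
elim: k {Lk} => [|k IHk]; first by rewrite !expr0 mul1r mul1e.
rewrite !exprS -mulrA; apply: le_trans (Vdil _ (lamk k)) _.
by rewrite EFinM -muleA; apply: lee_wpmul2l => //; rewrite lee_fin; lra.
Qed.

End Utility.

(** * Integrability of densities *)

Section Densities.
Context {R : realType} {d : measure_display} {Omega : measurableType d}
  (P : probability Omega R).
Implicit Types X Y Z D : Omega -> R.

Local Notation integr f := (P.-integrable setT (EFin \o f)).
Local Notation prodf X Z := (fun w => X w * Z w).

Lemma L1Q_integrable X Z : measurable_fun setT X -> measurable_fun setT Z ->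
  (forall w, 0 <= Z w) -> L1Q P Z X <-> integr (prodf X Z).
Proof.
move=> mX mZ Z0.
have E w : (`|X w| * Z w)%:E = (`|(EFin \o prodf X Z) w|)%E.
  by rewrite /= normrM [`|Z w|]ger0_norm.
rewrite /L1Q; under eq_integral do rewrite E; split => [h|/integrableP[]//].
by apply/integrableP; split => //; exact/measurable_EFinP/measurable_funM.
Qed.

Lemma density_integrable Z : is_density P Z -> integr Z.
Proof.
move=> [mZ Z0 intZ]; apply/integrableP; split; first exact/measurable_EFinP.
under eq_integral do rewrite /= ger0_norm//.
by rewrite intZ ltry.
Qed.

Lemma density_Rintegral Z : is_density P Z -> \int[P]_w Z w = 1 :> R.
Proof. by move=> [_ _ ZE]; rewrite /Rintegral ZE. Qed.

Lemma densityP Z : measurable_fun setT Z -> (forall w, 0 <= Z w) ->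
  integr Z -> \int[P]_w Z w = 1 :> R -> is_density P Z.
Proof.
move=> mZ Z0 iZ Z1; split => //.
by rewrite -[LHS]fineK ?(integrable_fin_num _ iZ)//; congr EFin.
Qed.

Lemma integrable_affine Z (A B : R) : integr Z -> integr (fun w => A + B * Z w).
Proof.
move=> iZ; apply: (@eq_integrable _ _ _ _ _ _ (cst A%:E \+ (fun w => B%:E * (EFin \o Z) w))%E) => //.
apply: integrableD => //; last exact: integrableZl.
exact: finite_measure_integrable_cst.
Qed.

(** * Stability of finite loss-entropy under domination *)

Section LossEntropy.
Context (a : \bar R) (U : R -> R).
Hypothesis ha : (a < +oo)%E.
Hypothesis hU_sconc : forall x y (t : R), dom a x -> dom a y -> x != y ->
  0 < t -> t < 1 -> t * U x + (1 - t) * U y < U (t * x + (1 - t) * y).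
Hypothesis hU_der : forall x, dom a x -> derivable U x 1.
Hypothesis hU_inada0_inf : a = -oo%E -> (derive1 U) x @[x --> -oo] --> +oo.
Hypothesis hU_inada_inf : (derive1 U) x @[x --> +oo] --> 0.
Hypothesis hU_ae : a = -oo%E ->
  exists c : R, 1 < c /\ \forall x \near -oo, c <= x * (derive1 U) x / U x.

(** Two dominating densities serve the average of two measures; [D1 = D2] serves the normalised
    polar element. For finite [a] the linear bound on [Vplus] and the integrability of [Z] suffice;
    for [a = -oo] the growth estimate is applied at the larger of [D1 w] and [D2 w]. *)
Lemma finite_loss_entropy_le Z D1 D2 (L : R) : is_density P Z ->
  is_density P D1 -> is_density P D2 -> (forall w, Z w <= L * (D1 w + D2 w)) ->
  finite_loss_entropy P a U D1 -> finite_loss_entropy P a U D2 ->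
  finite_loss_entropy P a U Z.
Proof.
move=> dZ dD1 dD2 ZL [b1 [_ fD1]] [b2 [_ fD2]].
have V0 y : (0 <= Vplus a U y)%E by rewrite le_max lexx orbT.
case Ea : a => [r| |]; last 2 first.
- by move: ha; rewrite Ea.
- have [y0 [y00 Vmono Vgrow]] :=
    Vplus_growth hU_sconc hU_der hU_inada0_inf hU_ae Ea.
  rewrite -Ea.
  pose L' := 2 * Num.max 1 L.
  have L'0 : 0 < L' by rewrite mulr_gt0// lt_max ltr01.
  have [C [C0 VC]] := Vgrow L'.
  pose y1 := Num.max y0 (Num.max b1 b2).
  have y01 : y0 <= y1 by rewrite le_max lexx.
  (* Above [y1] all three cut-offs are passed and [Vplus a U] is nondecreasing. So [h] is
     nondecreasing, hence measurable, and the integral of a sum can be split. *)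
  pose h y := if y1 <= y then Vplus a U y else 0%E.
  have h0 y : (0 <= h y)%E by rewrite /h; case: ifP.
  have mh : measurable_fun setT h.
    apply: nondecreasing_emeasurable => x y xy; rewrite /h.
    case: (leP y1 x) => [yx|_]; last by case: ifP.
    by rewrite (le_trans yx xy); apply: Vmono => //; exact: le_trans yx.
  have fh (D : Omega -> R) b : b <= y1 ->
      (\int[P]_w (if (b <= D w)%R then Vplus a U (D w) else 0%E) < +oo)%E ->
      (\int[P]_w h (D w) < +oo)%E.
    move=> by1; apply: le_lt_trans; apply: ae_ge0_le_lower_integral => //.
      by move=> w; case: ifP.
    apply: aeW => w; rewrite /h; case: ifPn => y1D; last by case: ifP.
    by rewrite (le_trans by1).
  have fh1 : (\int[P]_w h (D1 w) < +oo)%E.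
    by apply: fh fD1 => //; rewrite !le_max lexx orbT.
  have fh2 : (\int[P]_w h (D2 w) < +oo)%E.
    by apply: fh fD2 => //; rewrite !le_max lexx !orbT.
  (* If [Z w >= L' * y1], the larger of [D1 w] and [D2 w] is at least [y1], so [h] agrees with
     [Vplus a U] there. *)
  exists (Num.max y0 (L' * y1)); split; first by rewrite lt_max y00.
  have [mD1 D10 _] := dD1; have [mD2 D20 _] := dD2.
  apply: (@le_lt_trans _ _ (\int[P]_w (C%:E * (h (D1 w) + h (D2 w))))%E).
    apply: ae_ge0_le_lower_integral => [w|w|].
    + by case: ifP.
    + by rewrite mule_ge0 ?lee_fin ?adde_ge0.
    apply: aeW => w; case: ifPn => [|_]; last by rewrite mule_ge0 ?lee_fin ?adde_ge0.
    rewrite ge_max => /andP[Zy0 Zy1].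
    have ZD : Z w <= L' * Num.max (D1 w) (D2 w).
      apply: (le_trans (ZL w)); rewrite /L' -mulrA mulrCA.
      apply: (@le_trans _ _ (Num.max 1 L * (D1 w + D2 w))).
        by rewrite ler_wpM2r ?addr_ge0// le_max lexx orbT.
      rewrite ler_wpM2l//; first by rewrite le_max ler01.
      by rewrite mulr_natl mulr2n lerD// le_max lexx ?orbT.
    have [D12|D21] := leP (D1 w) (D2 w).
    + rewrite (max_r D12) in ZD.
      have yD : y1 <= D2 w by rewrite -(ler_pM2l L'0) (le_trans Zy1).
      apply: (le_trans (VC _ _ (le_trans y01 yD) Zy0 ZD)).
      apply: lee_wpmul2l; first by rewrite lee_fin.
      have <- : h (D2 w) = Vplus a U (D2 w) by rewrite /h yD.
      by rewrite leeDr.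
    + rewrite (max_l (ltW D21)) in ZD.
      have yD : y1 <= D1 w by rewrite -(ler_pM2l L'0) (le_trans Zy1).
      apply: (le_trans (VC _ _ (le_trans y01 yD) Zy0 ZD)).
      apply: lee_wpmul2l; first by rewrite lee_fin.
      have <- : h (D1 w) = Vplus a U (D1 w) by rewrite /h yD.
      by rewrite leeDl.
  have mhD D : measurable_fun setT D -> measurable_fun setT (fun w => h (D w)).
    by move=> mD; exact: (@measurableT_comp _ _ _ _ _ _ h).
  rewrite ge0_integralZl ?lee_fin//.
  + rewrite lte_mul_pinfty ?lee_fin// ge0_integralD//.
    * exact: lte_add_pinfty fh1 fh2.
    * exact: mhD.
    * exact: mhD.
  + by apply: emeasurable_funD; exact: mhD.
  + by move=> w _; rewrite adde_ge0.
have [A AP] := Vplus_linear_bound hU_sconc hU_der hU_inada_inf Ea.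
exists 1; split => //; rewrite -Ea.
have [mZ Z0 _] := dZ.
have gi := integrable_affine `|A| `|r| (density_integrable dZ).
apply: le_lt_trans (integrable_lty _ gi) => //.
apply: ae_ge0_le_lower_integral => [w|w|].
- by case: ifP.
- by rewrite lee_fin addr_ge0// mulr_ge0.
apply: aeW => w; case: ifPn => [Z1|_]; last by rewrite lee_fin addr_ge0// mulr_ge0.
by apply: le_trans (AP _ Z1) _; rewrite lee_fin lerD2r ler_norm.
Qed.

End LossEntropy.
End Densities.

(** * Superhedging duality, with the stability of the entropy condition as a hypothesis *)

Section Duality.
Context {R : realType} {d : measure_display} {Omega : measurableType d}
  (P : probability Omega R) (K : set (Omega -> R)) (a : \bar R) (U : R -> R).
Implicit Types X Y Z D W F : Omega -> R.
Hypothesis hK_meas : forall X, K X -> measurable_fun setT X.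
Hypothesis hK_ne : exists X, K X.
Hypothesis hK_cone : forall X Y (s t : R), K X -> K Y -> 0 <= s -> 0 <= t ->
  K (fun w => s * X w + t * Y w).
Hypothesis hMne : exists Z, MhatV P K a U Z.
Hypothesis entropy_le : forall Z D1 D2 (L : R), is_density P Z ->
  is_density P D1 -> is_density P D2 -> (forall w, Z w <= L * (D1 w + D2 w)) ->
  finite_loss_entropy P a U D1 -> finite_loss_entropy P a U D2 ->
  finite_loss_entropy P a U Z.

Local Notation integr f := (P.-integrable setT (EFin \o f)).
Local Notation M := (MhatV P K a U).
Local Notation LU := (LU P K a U).
Local Notation KU := (KU P K a U).
Local Notation CU := (CU P K a U).

(** Real-valued form of [EQ] and [pairing]: an infinite integral becomes [0], and the values agree
    when the product is integrable. *)
Definition expect X Z : R := \int[P]_w (X w * Z w).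

Lemma EQ_expect X Z : integr (fun w => X w * Z w) -> EQ P Z X = (expect X Z)%:E.
Proof. by move=> i; rewrite /expect /Rintegral fineK// (integrable_fin_num _ i). Qed.

Lemma LU_integrable X D : LU X -> M D -> integr (fun w => X w * D w).
Proof.
move=> [mX XL] MD; have [[[mD D0 _] _] _] := MD.
by apply/L1Q_integrable => //; exact: XL.
Qed.

Lemma LU_of_integrable X : measurable_fun setT X ->
  (forall D, M D -> integr (fun w => X w * D w)) -> LU X.
Proof.
move=> mX iX; split => // D MD; have [[[mD D0 _] _] _] := MD.
by apply/L1Q_integrable => //; exact: iX.
Qed.

Lemma K_LU X : K X -> LU X.
Proof. by move=> KX; split; [exact: hK_meas|move=> Z [[_ /(_ _ KX)[]]]]. Qed.

Lemma integrable_comb X Y (s t : R) : integr X -> integr Y ->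
  integr (fun w => s * X w + t * Y w).
Proof.
move=> iX iY.
apply: (@eq_integrable _ _ _ _ _ _ ((fun w => s%:E * (EFin \o X) w) \+
  (fun w => t%:E * (EFin \o Y) w))%E) => //.
by apply: integrableD => //; exact: integrableZl.
Qed.

Lemma Rintegral_comb X Y (s t : R) : integr X -> integr Y ->
  \int[P]_w (s * X w + t * Y w) = s * \int[P]_w X w + t * \int[P]_w Y w :> R.
Proof.
move=> iX iY; rewrite RintegralD//; last 2 first.
- by apply: (@eq_integrable _ _ _ _ _ _ (fun w => s%:E * (EFin \o X) w)%E) => //; exact: integrableZl.
- by apply: (@eq_integrable _ _ _ _ _ _ (fun w => t%:E * (EFin \o Y) w)%E) => //; exact: integrableZl.
by rewrite !RintegralZl.
Qed.

Lemma LU_comb X Y (s t : R) : LU X -> LU Y -> LU (fun w => s * X w + t * Y w).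
Proof.
move=> LX LY; apply: LU_of_integrable => [|D MD].
  apply: measurable_funD; apply: measurable_funM => //.
    exact: LX.1.
  exact: LY.1.
have := integrable_comb s t (LU_integrable LX MD) (LU_integrable LY MD).
by apply: eq_integrable => // w _; rewrite /= !mulrA -mulrDl.
Qed.

Lemma LU_bounded X (B : R) : measurable_fun setT X -> (forall w, `|X w| <= B) ->
  LU X.
Proof.
move=> mX XB; apply: LU_of_integrable => // D MD; have [[dD _] _] := MD.
have [mD D0 _] := dD.
have := integrable_affine 0 B (density_integrable dD).
apply: le_integrable => //.
  exact/measurable_EFinP/measurable_funM.
move=> w _; rewrite /= lee_fin add0r normrM (ger0_norm (D0 w)).
by apply: le_trans (ler_norm _); rewrite ler_wpM2r.
Qed.

(** Each of [D1] and [D2] is at most twice the average, so a single density can dominate both. *)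
Lemma MhatV_average D1 D2 : M D1 -> M D2 -> M (fun w => 2^-1 * D1 w + 2^-1 * D2 w).
Proof.
move=> MD1 MD2; have [[dD1 KD1] fD1] := MD1; have [[dD2 KD2] fD2] := MD2.
have [mD1 D10 _] := dD1; have [mD2 D20 _] := dD2.
have dD : is_density P (fun w => 2^-1 * D1 w + 2^-1 * D2 w).
  apply: densityP => [|w||].
  - by apply: measurable_funD; exact: measurable_funM.
  - by rewrite addr_ge0// mulr_ge0.
  - by apply: integrable_comb; exact: density_integrable.
  - rewrite Rintegral_comb; [|exact: density_integrable..].
    by rewrite !density_Rintegral//; lra.
split; last first.
  by apply: (@entropy_le _ D1 D2 2^-1) => // w; rewrite mulrDr.
split => // X KX; have LX := K_LU KX.
have i1 := LU_integrable LX MD1; have i2 := LU_integrable LX MD2.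
have E : (fun w => X w * (2^-1 * D1 w + 2^-1 * D2 w)) =
    (fun w => 2^-1 * (X w * D1 w) + 2^-1 * (X w * D2 w)).
  by apply/funext => w; ring.
have i : integr (fun w => X w * (2^-1 * D1 w + 2^-1 * D2 w)).
  by rewrite E; exact: integrable_comb.
split; first by case: dD => mD D0 _; apply/L1Q_integrable => //; exact: hK_meas.
rewrite EQ_expect// lee_fin /expect E Rintegral_comb//.
have := (KD1 _ KX).2; have := (KD2 _ KX).2; rewrite !EQ_expect// !lee_fin /expect.
by lra.
Qed.

(** Working class in place of [LVplus]: it contains a measurable version of each element of
    [LVplus], is linear, pairs integrably with [LU], and survives taking positive parts. *)
Definition dominated Z := measurable_fun setT Z /\
  exists (L : R) D, [/\ 0 <= L, M D & forall w, `|Z w| <= L * D w].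

Lemma dominated_MhatV D : M D -> dominated D.
Proof.
move=> MD; have [[[mD D0 _] _] _] := MD; split => //.
by exists 1, D; split => // w; rewrite mul1r ger0_norm.
Qed.

Lemma dominated_comb Z1 Z2 (s t : R) : dominated Z1 -> dominated Z2 ->
  dominated (fun w => s * Z1 w + t * Z2 w).
Proof.
move=> [mZ1 [L1 [D1 [L10 MD1 ZD1]]]] [mZ2 [L2 [D2 [L20 MD2 ZD2]]]]; split.
  by apply: measurable_funD; exact: measurable_funM.
exists (2 * (`|s| * L1 + `|t| * L2)), (fun w => 2^-1 * D1 w + 2^-1 * D2 w).
split; [|exact: MhatV_average|].
  by rewrite mulr_ge0// addr_ge0// mulr_ge0.
have [[[_ D10 _] _] _] := MD1; have [[[_ D20 _] _] _] := MD2.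
move=> w; apply: (le_trans (ler_normD _ _)); rewrite !normrM.
have h1 : `|s| * `|Z1 w| <= `|s| * (L1 * D1 w) by rewrite ler_wpM2l.
have h2 : `|t| * `|Z2 w| <= `|t| * (L2 * D2 w) by rewrite ler_wpM2l.
have h3 : 0 <= `|s| * L1 * D2 w by rewrite !mulr_ge0.
have h4 : 0 <= `|t| * L2 * D1 w by rewrite !mulr_ge0.
move: `|s| `|t| `|Z1 w| `|Z2 w| h1 h2 h3 h4 => s' t' z1 z2.
by lra.
Qed.

Lemma dominated_sum n (c : 'I_n -> R) (Z : 'I_n -> Omega -> R) :
  (forall i, dominated (Z i)) -> dominated (fun w => \sum_(i < n) c i * Z i w).
Proof.
elim: n c Z => [|n IHn] c Z dZ.
  (* The empty sum is the zero function, which needs some density to dominate it. *)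
  have [D MD] := hMne; have dD := dominated_MhatV MD.
  have := dominated_comb 0 0 dD dD; congr dominated.
  by apply/funext => w; rewrite big_ord0; lra.
have := dominated_comb (c ord0) 1 (dZ ord0)
  (IHn (fun i => c (lift ord0 i)) _ (fun i => dZ (lift ord0 i))).
by congr dominated; apply/funext => w; rewrite big_ord_recl mul1r.
Qed.

Lemma LVplus_dominated Z : LVplus P K a U Z ->
  exists W, dominated W /\ {ae P, forall w, Z w = W w}.
Proof.
move=> [n [c [Zs [MZs ZE]]]]; exists (fun w => \sum_(i < n) c i * Zs i w).
by split => //; apply: dominated_sum => i; exact: dominated_MhatV.
Qed.

Lemma dominated_integrable X Z : LU X -> dominated Z ->
  integr (fun w => X w * Z w).
Proof.
move=> LX [mZ [L [D [L0 MD ZD]]]]; have [mX _] := LX.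
have [[[_ D0 _] _] _] := MD.
have := integrable_affine 0 L (LU_integrable LX MD).
apply: le_integrable => //.
  exact/measurable_EFinP/measurable_funM.
move=> w _; rewrite /= lee_fin add0r !normrM (ger0_norm L0) mulrCA.
by rewrite ler_wpM2l// (ger0_norm (D0 w)).
Qed.

(** * Bilinearity and monotonicity of the pairing *)

Lemma expect_combl X Y Z (s t : R) : LU X -> LU Y -> dominated Z ->
  expect (fun w => s * X w + t * Y w) Z = s * expect X Z + t * expect Y Z.
Proof.
move=> LX LY dZ; rewrite /expect -Rintegral_comb; [|exact: dominated_integrable..].
by apply: eq_Rintegral => w _; ring.
Qed.

Lemma expect_combr X Z1 Z2 (s t : R) : LU X -> dominated Z1 -> dominated Z2 ->
  expect X (fun w => s * Z1 w + t * Z2 w) = s * expect X Z1 + t * expect X Z2.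
Proof.
move=> LX d1 d2; rewrite /expect -Rintegral_comb; [|exact: dominated_integrable..].
by apply: eq_Rintegral => w _; ring.
Qed.

Lemma expect_sumr n (c : 'I_n -> R) (Z : 'I_n -> Omega -> R) X : LU X ->
  (forall i, dominated (Z i)) ->
  expect X (fun w => \sum_(i < n) c i * Z i w) = \sum_(i < n) c i * expect X (Z i).
Proof.
move=> LX; elim: n c Z => [|n IHn] c Z dZ.
  rewrite big_ord0 /expect.
  transitivity (\int[P]_w (0 : R)); last by rewrite Rintegral_cst// mul0r.
  by apply: eq_Rintegral => w _; rewrite big_ord0 mulr0.
rewrite big_ord_recl -IHn// -[X in _ + X]mul1r -expect_combr//; last first.
  exact: dominated_sum.
by congr expect; apply/funext => w; rewrite big_ord_recl mul1r.
Qed.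

Lemma pairing_ae F Z W : LU F -> dominated W -> {ae P, forall w, Z w = W w} ->
  pairing P F Z = (expect F W)%:E.
Proof.
move=> LF dW ZW; rewrite -EQ_expect; last exact: dominated_integrable.
by apply: ae_eq_lower_integral; apply: filterS ZW => w ->.
Qed.

Lemma expect_ae_le X Y D : LU X -> LU Y -> M D ->
  {ae P, forall w, X w <= Y w} -> expect X D <= expect Y D.
Proof.
move=> LX LY MD XY; have [[[mD D0 _] _] _] := MD.
have dD := dominated_MhatV MD.
have LB := LU_comb 1 (-1) LY LX.
suff : 0 <= expect (fun w => 1 * Y w + (-1) * X w) D.
  by rewrite expect_combl//; lra.
(* [F] equals the integrand a.e. and is nonnegative at every point. *)
pose F w := Num.max 0 ((1 * Y w + (-1) * X w) * D w).
have -> : expect (fun w => 1 * Y w + (-1) * X w) D = \int[P]_w F w.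
  rewrite /expect /Rintegral; congr fine; apply: ae_eq_lower_integral.
  apply: filterS XY => w XYw; rewrite /F max_r// mulr_ge0//; lra.
by apply: Rintegral_ge0 => w _; rewrite /F le_max lexx.
Qed.

(** * The cone [KU], its closure, and the bound of the price from below *)

Lemma KU_K X : K X -> KU X.
Proof. by move=> KX; split; [exact: K_LU|exists X; split => //; exact: aeW]. Qed.

Lemma KU_nonpos Y : LU Y -> (forall w, Y w <= 0) -> KU Y.
Proof.
move=> LY Y0; split => //; have [X KX] := hK_ne.
exists (fun w => 0 * X w + 0 * X w); split; first exact: hK_cone.
by apply: aeW => w; rewrite !mul0r addr0.
Qed.

Lemma KU_comb X Y (s t : R) : KU X -> KU Y -> 0 <= s -> 0 <= t ->
  KU (fun w => s * X w + t * Y w).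
Proof.
move=> [LX [X' [KX' XX']]] [LY [Y' [KY' YY']]] s0 t0; split; first exact: LU_comb.
exists (fun w => s * X' w + t * Y' w); split; first exact: hK_cone.
by apply: filterS2 XX' YY' => w Xw Yw; rewrite lerD// ler_wpM2l.
Qed.

Lemma KU_expect_le0 Y D : KU Y -> M D -> expect Y D <= 0.
Proof.
move=> [LY [X [KX YX]]] MD; have LX := K_LU KX.
apply: (le_trans (expect_ae_le LY LX MD YX)).
have [[_ /(_ _ KX)[_ +]] _] := MD.
by rewrite EQ_expect ?lee_fin//; exact: LU_integrable.
Qed.

(** Otherwise the neighbourhood of [Y] given by the single functional [D] and radius [expect Y D]
    would contain an element of [KU] with positive expectation. *)
Lemma CU_expect_le0 Y D : CU Y -> M D -> expect Y D <= 0.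
Proof.
move=> [LY CY] MD; rewrite leNgt; apply/negP => YD.
have LD : LVplus P K a U D.
  exists 1%N, (fun=> 1), (fun=> D); split => //.
  by apply: aeW => w; rewrite big_ord1 mul1r.
have dD := dominated_MhatV MD.
have [Y' [KY' /(_ ord0)]] := CY 1%N (fun=> D) _ (fun=> LD) YD.
have [LY' _] := KY'.
have -> : (fun w => Y' w - Y w) = (fun w => 1 * Y' w + (-1) * Y w).
  by apply/funext => w; ring.
rewrite (@pairing_ae _ _ D)//; [|exact: LU_comb|exact: aeW].
rewrite expect_combl// /= lte_fin.
have := KU_expect_le0 KY' MD; move: (expect Y' D) (expect Y D) YD => y' y y0 y'0.
by rewrite ltr_norml => /andP[]; lra.
Qed.

Lemma density_expect_cst D (x : R) : M D -> expect (cst x) D = x.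
Proof.
move=> [[dD _] _]; rewrite /expect RintegralZl ?density_Rintegral ?mulr1//.
exact: density_integrable.
Qed.

Lemma LU_cst (x : R) : LU (cst x).
Proof. exact: (@LU_bounded _ `|x|). Qed.

Lemma MhatV_le_price X D : LU X -> M D ->
  (EQ P D X <= superhedging_price P K a U X)%E.
Proof.
move=> LX MD; rewrite EQ_expect; last exact: LU_integrable.
apply: le_ereal_inf_tmp => _ [x [Y [CY XY]] <-]; rewrite lee_fin.
have LY := CY.1; have Lx := LU_cst x.
have LxY := LU_comb 1 1 Lx LY.
have : {ae P, forall w, X w <= 1 * cst x w + 1 * Y w}.
  by apply: filterS XY => w; rewrite !mul1r.
move=> /(expect_ae_le LX LxY MD) /le_trans; apply.
rewrite expect_combl//; last exact: dominated_MhatV.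
by rewrite density_expect_cst//; have := CU_expect_le0 CY MD; lra.
Qed.

(** * The polar of [KU] and the bound of the price from above *)

Lemma Rintegral_le0_ae0 (f : Omega -> R) : measurable_fun setT f -> (forall w, 0 <= f w) ->
  integr f -> \int[P]_w f w <= 0 :> R -> {ae P, forall w, f w = 0}.
Proof.
move=> mf f0 fi If.
have : (\int[P]_w `|(f w)%:E| = 0)%E.
  under eq_integral do rewrite /= ger0_norm//.
  apply/eqP; rewrite eq_le integral_ge0// ?andbT.
    by rewrite -[leLHS]fineK ?(integrable_fin_num _ fi)// lee_fin.
  by move=> w _; rewrite lee_fin.
move/(ae_eq_integral_abs P measurableT _).1.
move=> /(_ ((measurable_EFinP _ _).2 mf)) /=.
by apply: filterS => w /(_ I) [].
Qed.

(* Testing the polar condition on the indicator of {Z < 0} shows that Z is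
   nonnegative, and normalising it stays within the dominated class. *)
Lemma polar_MhatV Z X : dominated Z -> (forall Y, KU Y -> expect Y Z <= 0) ->
  LU X -> 0 < expect X Z -> exists D, M D /\ 0 < expect X D.
Proof.
move=> dZ polZ LX XZ; have [mZ [L [D [L0 MD ZD]]]] := dZ.
have [[dD _] fD] := MD; have [mD D0 _] := dD.
pose N := [set w | Z w < 0].
have mN : measurable N.
  by rewrite -[N]setTI; apply: (measurable_fun_ltr mZ).
pose Y w : R := - \1_N w.
have mY : measurable_fun setT Y by apply: measurable_funN; exact: measurable_indic.
have LY : LU Y.
  apply: (@LU_bounded _ 1) => // w; rewrite /Y normrN indicE.
  by case: (w \in N); rewrite ?normr1 ?normr0.
have KY : KU Y by apply: KU_nonpos => // w; rewrite /Y oppr_le0 indicE.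
(* [is_density] asks for nonnegativity at every point, so [Z] is replaced by its positive part,
   which is a.e. equal to it. *)
pose Zp w := Num.max (Z w) 0.
have YZ0 w : 0 <= Y w * Z w.
  rewrite /Y indicE; have [|] := boolP (w \in N).
    by rewrite inE /N/= mulNr mul1r oppr_ge0 => /ltW.
  by rewrite oppr0 mul0r.
have ZZp : {ae P, forall w, Z w = Zp w}.
  have := Rintegral_le0_ae0 (measurable_funM mY mZ) YZ0
    (dominated_integrable LY dZ) (polZ _ KY).
  apply: filterS => w; rewrite /Zp; have [//|Zw] := leP 0 (Z w).
  by rewrite /= /Y indicE mem_set// mulN1r => /eqP; rewrite oppr_eq0 => /eqP.
have mZp : measurable_fun setT Zp by exact: measurable_maxr.
have Zp0 w : 0 <= Zp w by rewrite /Zp le_max lexx orbT.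
have ZpD w : Zp w <= L * D w.
  by rewrite /Zp ge_max mulr_ge0// andbT (le_trans (ler_norm _)).
have dZp : dominated Zp.
  by split => //; exists L, D; split => // w; rewrite ger0_norm.
have expZp F : LU F -> expect F Z = expect F Zp.
  move=> LF; have := pairing_ae LF dZp ZZp.
  by rewrite (@pairing_ae _ _ Z)//; [move=> []|exact: aeW].
have iZp : integr Zp.
  have := dominated_integrable (LU_cst 1) dZp.
  by apply: eq_integrable => // w _; rewrite /= mul1r.
pose m := \int[P]_w Zp w : R.
(* Zero mass would make [Zp] vanish a.e., against [0 < expect X Z]. *)
have m0 : 0 < m.
  rewrite ltNge; apply/negP => /(Rintegral_le0_ae0 mZp Zp0 iZp) Zp_ae0.
  move: XZ; rewrite expZp// /expect /Rintegral.
  rewrite (@ae_eq_lower_integral _ _ _ P _ (cst 0%E)) ?integral0 ?ltxx//.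
  by apply: filterS Zp_ae0 => w ->; rewrite mulr0.
pose D' w := m^-1 * Zp w.
have D'E : D' = (fun w => m^-1 * Zp w + 0 * Zp w).
  by apply/funext => w; rewrite mul0r addr0.
have dD' : dominated D' by rewrite D'E; exact: dominated_comb.
have expD' F : LU F -> expect F D' = m^-1 * expect F Z.
  by move=> LF; rewrite D'E expect_combr// mul0r addr0 expZp.
have mV0 : 0 <= m^-1 by rewrite invr_ge0 ltW.
have densD' : is_density P D'.
  apply: densityP => [|w||]; first exact: dD'.1.
  - by rewrite mulr_ge0.
  - have := dominated_integrable (LU_cst 1) dD'.
    by apply: eq_integrable => // w _; rewrite /= mul1r.
  - by rewrite RintegralZl// mulVf// gt_eqF.
exists D'; split; last by rewrite expD'// mulr_gt0// invr_gt0.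
split; last first.
  apply: (@entropy_le _ D D (m^-1 * L)) => // w.
  rewrite /D' -mulrA ler_wpM2l// (le_trans (ZpD w))// mulrDr lerDl.
  by rewrite mulr_ge0.
split => // F KF; have LF := K_LU KF; have iF := dominated_integrable LF dD'.
split.
  by have [? ? _] := densD'; apply/L1Q_integrable => //; exact: hK_meas.
rewrite EQ_expect// lee_fin expD'// pmulr_rle0 ?invr_gt0// polZ//.
exact: KU_K.
Qed.

Lemma CU_of_expect_le X (x : R) : LU X -> (forall D, M D -> expect X D <= x) ->
  CU (fun w => X w - x).
Proof.
move=> LX Xx.
have X0E : (fun w => X w - x) = (fun w => 1 * X w + (-1) * cst x w).
  by apply/funext => w; rewrite mul1r mulN1r.
have Lx := LU_cst x; have LX0 : LU (fun w => X w - x) by rewrite X0E; exact: LU_comb.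
split => // n Zs eps LZs eps0; apply: contrapT => noY.
have [Ws WsP] := choice (fun i => LVplus_dominated (LZs i)).
pose T Y : 'rV[R]_n := \row_i expect Y (Ws i).
have T_comb Y Y' (s t : R) : LU Y -> LU Y' ->
    T (fun w => s * Y w + t * Y' w) = s *: T Y + t *: T Y'.
  move=> LY LY'; apply/rowP => i; rewrite !mxE expect_combl//.
  exact: (WsP i).1.
have [||||c [cK cX]] := @cone_separation R n (T @` KU) (T (fun w => X w - x)) eps.
- exists (cst 0); first by apply: KU_nonpos => //; exact: LU_cst.
  have := T_comb (cst 0) (cst 0) 0 0 (LU_cst 0) (LU_cst 0).
  rewrite !scale0r addr0 => <-; congr T.
  by apply/funext => w; rewrite mul0r addr0.
- move=> _ _ s t [Y KY <-] [Y' KY' <-] s0 t0.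
  exists (fun w => s * Y w + t * Y' w); first exact: KU_comb.
  by apply: T_comb; [case: KY|case: KY'].
- exact: eps0.
- move=> _ [Y KY <-]; apply: contrapT => noi; apply: noY; exists Y; split => // i.
  have LY := KY.1.
  have YE : (fun w => Y w - (X w - x)) = (fun w => 1 * Y w + (-1) * (X w - x)).
    by apply/funext => w; rewrite mul1r mulN1r.
  rewrite YE (pairing_ae _ (WsP i).1 (WsP i).2); last exact: LU_comb.
  rewrite expect_combl//; last exact: (WsP i).1.
  rewrite mul1r mulN1r /= lte_fin ltNge; apply/negP => epsi; apply: noi.
  by exists i; rewrite !mxE.
pose Z w := \sum_(i < n) c ord0 i * Ws i w.
have dZ : dominated Z by apply: dominated_sum => i; exact: (WsP i).1.
have expZ Y : LU Y -> expect Y Z = dotp c (T Y).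
  move=> LY; rewrite expect_sumr//; last by move=> i; exact: (WsP i).1.
  by apply: eq_bigr => i _; rewrite !mxE.
have [||//||D [MD]] := @polar_MhatV Z (fun w => X w - x).
- exact: dZ.
- by move=> Y KY; rewrite expZ; [apply: cK; exists Y|case: KY].
- by rewrite expZ.
rewrite X0E expect_combl//; last exact: dominated_MhatV.
by rewrite density_expect_cst//; have := Xx _ MD; lra.
Qed.

Lemma price_le (X : Omega -> R) (x : R) : LU X ->
  (forall D, M D -> expect X D <= x) ->
  (superhedging_price P K a U X <= x%:E)%E.
Proof.
move=> LX Xx; apply: ereal_inf_lbound; exists x => //.
exists (fun w => X w - x); split; first exact: CU_of_expect_le.
by apply: aeW => w; rewrite subrKC.
Qed.

Lemma price_eq_sup X : LU X -> superhedging_price P K a U X =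
  ereal_sup [set EQ P Z X | Z in MhatV P K a U].
Proof.
move=> LX; apply/eqP; rewrite eq_le; apply/andP; split; last first.
  by apply: ge_ereal_sup => _ [D MD <-]; exact: MhatV_le_price.
have EQle D : M D -> ((expect X D)%:E <= ereal_sup [set EQ P Z X | Z in M])%E.
  move=> MD; rewrite -EQ_expect; last exact: LU_integrable.
  by apply: ereal_sup_ubound; exists D.
(* A supremum [+oo] bounds every price, and [hMne] excludes [-oo]; a real supremum is itself an
   admissible initial capital. *)
case E : (ereal_sup _) => [r| |]; last 2 first.
- exact: leey.
- by have [D MD] := hMne; have := EQle _ MD; rewrite E.
by apply: price_le => // D MD; rewrite -lee_fin -E; exact: EQle.
Qed.

End Duality.

Theorem theorem5p3 (R : realType) (d : measure_display) (Omega : measurableType d)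
  (P : probability Omega R)
  (K : set (Omega -> R))
  (hK_meas : forall X, K X -> measurable_fun setT X)
  (hK_ne : exists X, K X)
  (hK_cone : forall X Y (s t : R), K X -> K Y -> 0 <= s -> 0 <= t ->
     K (fun w => s * X w + t * Y w))
  (a : \bar R) (U : R -> R)
  (ha : (a < +oo)%E)
  (hU_incr : forall x y, dom a x -> dom a y -> x < y -> U x < U y)
  (hU_sconc : forall x y (t : R), dom a x -> dom a y -> x != y -> 0 < t -> t < 1 ->
     t * U x + (1 - t) * U y < U (t * x + (1 - t) * y))
  (hU_der : forall x, dom a x -> derivable U x 1)
  (hU_C1 : {in dom a, continuous ((derive1 U))})
  (hU_inada0_fin : forall r : R, a = r%:E -> (derive1 U) x @[x --> r^'+] --> +oo)
  (hU_inada0_inf : a = -oo%E -> (derive1 U) x @[x --> -oo] --> +oo)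
  (hU_inada_inf : (derive1 U) x @[x --> +oo] --> 0)
  (hU_ae : a = -oo%E ->
     exists c : R, 1 < c /\ \forall x \near -oo, c <= x * (derive1 U) x / U x)
  (hMne : exists Z, MhatV P K a U Z) :
  forall X, LU P K a U X ->
    superhedging_price P K a U X =
    ereal_sup [set EQ P Z X | Z in MhatV P K a U].
Proof.
move=> X LX; apply: price_eq_sup => // Z D1 D2 L.
exact: finite_loss_entropy_le.
Qed.
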